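(* Let $p$ be a prime and let $(a_k)_{k\in\mathbb{N}}$ be a sequence in $\mathbb{Z}_p$ such that the series $\sum_{k\in\mathbb{N}}a_k\widehat{P}_k(x)$ converges in $\mathbb{Z}_p$ for every $x\in\mathbb{Z}_p$, and let $\Phi:\mathbb{Z}_p\to\mathbb{Z}_p$ be $\Phi(x)=\sum_{k\in\mathbb{N}}a_k\widehat{P}_k(x)$. Then $\Phi$ is congruence preserving if and only if $\mathrm{lcm}(k)$ divides $a_k$ in $\mathbb{Z}_p$ for all $k$, i.e. for all $i$ and all $k\ge p^i$, $a_k=p^ib_k$ for some $b_k\in\mathbb{Z}_p$.
   Context: $\mathbb{Z}_p$ is the ring of $p$-adic integers. $\mathrm{lcm}(k)$ is the least common multiple of $1,\dots,k$ ($\mathrm{lcm}(0)=1$). $P_k(x)=\binom{x}{k}=\frac1{k!}\prod_{\ell=0}^{k-1}(x-\ell)$, and $\widehat{P}_k:\mathbb{Z}_p\to\mathbb{Z}_p$ is its interpretation on $\mathbb{Z}_p$: $\widehat{P}_k=\varprojlim_n P_k^{p^n,p^n}$ where $P_k^{p^n,p^n}=\pi_{p^n}\circ P_k\circ\iota_{p^n}$ on $\mathbb{Z}/p^n\mathbb{Z}$ ($\iota_{p^n}$ giving the representative in $\{0,\dots,p^n-1\}$); equivalently the unique continuous extension of $x\mapsto\binom{x}{k}$ from $\mathbb{N}$ to $\mathbb{Z}_p$. A function $\Phi:\mathbb{Z}_p\to\mathbb{Z}_p$ is congruence preserving if for all $x,y$ there is $d\in\mathbb{Z}_p$ with $\Phi(x)-\Phi(y)=d(x-y)$.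 *)

(* Defs.v *)
(* MathComp and MathComp-Analysis *)
From HB Require Import structures.
From mathcomp Require Import all_boot all_order all_algebra.
From mathcomp Require Import all_classical all_reals all_analysis.

Set Implicit Arguments.
Unset Strict Implicit.
Unset Printing Implicit Defensive.

Import GRing.Theory.
Local Open Scope classical_set_scope.
Local Open Scope ring_scope.

(* x n is the canonical representative in {0, ..., p ^ n - 1} of the class of
   level n; the condition at n also forces x n < p ^ n when 0 < p. *)
Definition padic_coherent (p : nat) (x : nat -> nat) : bool :=
  `[< forall n, (x n.+1 %% p ^ n)%N = x n >].

(* The p-adic integers, as the inverse limit of the rings Z/p^nZ. *)
Record padic_int (p : nat) (p_pr : prime p) := PadicInt {
  residue :> nat -> nat;
  residueP : padic_coherent p residue }.

Section PadicInt.
Variables (p : nat) (p_pr : prime p).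
Local Notation Zp := (padic_int p_pr).

HB.instance Definition _ := [isSub for @residue p p_pr].
HB.instance Definition _ := [Choice of Zp by <:].

Lemma residueS (x : Zp) n : (x n.+1 %% p ^ n)%N = x n.
Proof. exact: (asboolP _ (residueP x) n). Qed.

Lemma residue_mod (x : Zp) n : (x n %% p ^ n)%N = x n.
Proof. by rewrite -residueS modn_mod. Qed.

Lemma padicP (x y : Zp) : (forall n, x n = y n) -> x = y.
Proof. by move=> xy; apply/val_inj/funext. Qed.

Lemma padic_of_subproof (f : nat -> nat) :
    (forall n, f n.+1 = f n %[mod p ^ n]) ->
  padic_coherent p (fun n => f n %% p ^ n)%N.
Proof.
by move=> fP; apply/asboolP => n; rewrite modn_dvdm ?fP // expnS dvdn_mull.
Qed.

Definition padic_of f fP : Zp := PadicInt p_pr (@padic_of_subproof f fP).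

Fact padic0_subproof n : 0 = 0 %[mod p ^ n]. Proof. by []. Qed.
Fact padic1_subproof n : 1 = 1 %[mod p ^ n]. Proof. by []. Qed.

Fact padicN_subproof (x : Zp) n :
  (p ^ n.+1 - x n.+1 = p ^ n - x n %[mod p ^ n])%N.
Proof.
have p_gt0 k : (0 < p ^ k)%N by rewrite expn_gt0 prime_gt0.
have le_x k : (x k <= p ^ k)%N by rewrite -residue_mod ltnW ?ltn_mod.
apply/eqP; rewrite -(eqn_modDr (x n)) subnK // modnn.
by rewrite -(residueS x n) modnDmr subnK // expnS modnMl.
Qed.

Fact padicD_subproof (x y : Zp) n :
  (x n.+1 + y n.+1 = x n + y n %[mod p ^ n])%N.
Proof. by rewrite -modnDm !residueS. Qed.

Fact padicM_subproof (x y : Zp) n :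
  (x n.+1 * y n.+1 = x n * y n %[mod p ^ n])%N.
Proof. by rewrite -modnMm !residueS. Qed.

Definition padic0 : Zp := padic_of padic0_subproof.
Definition padic1 : Zp := padic_of padic1_subproof.
Definition padicN x : Zp := padic_of (padicN_subproof x).
Definition padicD x y : Zp := padic_of (padicD_subproof x y).
Definition padicM x y : Zp := padic_of (padicM_subproof x y).

Fact padicDA : associative padicD.
Proof. by move=> x y z; apply: padicP => n /=; rewrite modnDmr modnDml addnA. Qed.

Fact padicDC : commutative padicD.
Proof. by move=> x y; apply: padicP => n /=; rewrite addnC. Qed.

Fact padic0D : left_id padic0 padicD.
Proof. by move=> x; apply: padicP => n /=; rewrite mod0n residue_mod. Qed.

Fact padicND : left_inverse padic0 padicN padicD.
Proof.
move=> x; apply: padicP => n /=; rewrite modnDml subnK ?modnn ?mod0n //.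
by rewrite -residue_mod ltnW // ltn_mod expn_gt0 prime_gt0.
Qed.

HB.instance Definition _ :=
  GRing.isZmodule.Build Zp padicDA padicDC padic0D padicND.

Fact padicMA : associative padicM.
Proof. by move=> x y z; apply: padicP => n /=; rewrite modnMmr modnMml mulnA. Qed.

Fact padicMC : commutative padicM.
Proof. by move=> x y; apply: padicP => n /=; rewrite mulnC. Qed.

Fact padic1M : left_id padic1 padicM.
Proof. by move=> x; apply: padicP => n /=; rewrite modnMml mul1n residue_mod. Qed.

Fact padicMDl : left_distributive padicM padicD.
Proof.
by move=> x y z; apply: padicP => n /=; rewrite modnMml modnDm mulnDl.
Qed.

Fact padic1_neq0 : padic1 != padic0.
Proof.
apply/eqP => /(congr1 (fun x : Zp => x 1)) /=.
by rewrite mod0n expn1 modn_small ?prime_gt1.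
Qed.

HB.instance Definition _ := GRing.Zmodule_isComNzRing.Build Zp
  padicMA padicMC padic1M padicMDl padic1_neq0.

HB.instance Definition _ := isPointed.Build Zp 0.

(* The p-adic topology is the inverse limit one, i.e., the topology induced by
   the product topology on nat -> nat for the discrete topology of nat. *)
Definition padic_proj (x : Zp) : {ptws nat -> nat} := residue x.

HB.instance Definition _ := Uniform.copy Zp (initial_topology padic_proj).

End PadicInt.

Section PadicFunctions.
Variables (p : nat) (p_pr : prime p).
Local Notation Zp := (padic_int p_pr).

(* The map x |-> 'C(x, k) on Z/p^nZ = {0, ..., p ^ n - 1}. *)
Definition bin_mod (k n x : nat) : nat := ('C(x, k) %% p ^ n)%N.

(* The maps bin_mod k n are not compatible with reduction modulo p ^ n (take
   p = k = 2 and x = - 1), so their limit as n grows is the p-adic limit of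
   their values at the residues of x rather than a coherent sequence. This limit
   exists because x |-> 'C(x, k) is p-adically uniformly continuous on nat. *)
Definition padic_bin (k : nat) (x : Zp) : Zp :=
  limn (fun n => (bin_mod k n (x n))%:R : Zp).

Definition padic_dvd (a b : Zp) : Prop := exists d : Zp, b = d * a.

Definition congruence_preserving (Phi : Zp -> Zp) : Prop :=
  forall x y : Zp, padic_dvd (x - y) (Phi x - Phi y).

End PadicFunctions.

Definition lcm_upto (k : nat) : nat := \big[lcmn/1%N]_(1 <= i < k.+1) i.

(* Main.v *)
(* Every h divides j C(h, j), so Vandermonde's formula shows that x - y divides
   lcm(k) (C(x, k) - C(y, k)) for naturals x, y, and by continuity for p-adic
   integers: if lcm(k) divides every a_k, each term of the series is congruence
   preserving. Conversely, let k >= p ^ i and compare the finite sums Phi(k) and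
   Phi(k - p ^ i): their terms of index k are a_k and 0, and modulo p ^ i the
   terms of smaller index agree by induction on k, so p ^ i divides a_k. *)
Require Import Defs.
From HB Require Import structures.
From mathcomp Require Import all_boot all_order all_algebra.
From mathcomp Require Import all_classical all_reals all_analysis.
From mathcomp Require Import zify.

Set Implicit Arguments.
Unset Strict Implicit.
Unset Printing Implicit Defensive.

Import GRing.Theory.
Local Open Scope classical_set_scope.
Local Open Scope ring_scope.

(** * Divisibility of lcm(k) and congruences between binomial coefficients *)

Lemma dvdn_lcm_upto i k : (0 < i)%N -> (i <= k)%N -> (i %| lcm_upto k)%N.
Proof.
case: i => // i _ ik; rewrite /lcm_upto big_add1 big_mkord.
exact: (biglcmn_sup (Ordinal ik)).
Qed.

Lemma lcm_upto_gt0 k : (0 < lcm_upto k)%N.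
Proof.
rewrite /lcm_upto big_add1 big_mkord.
by elim/big_ind: _ => // m n m0 n0; rewrite lcmn_gt0 m0.
Qed.

(** The p-part of an lcm is the lcm of the p-parts; those of 1, ..., k are powers of p at most k,
    and the largest such power is itself one of these numbers. *)
Lemma logn_lcm_upto p k : prime p -> logn p (lcm_upto k) = trunc_log p k.
Proof.
move=> p_pr; have p_gt1 := prime_gt1 p_pr.
have [->|k_gt0] := posnP k.
  by rewrite /lcm_upto big_geq // logn1 trunc_log0.
apply/eqP; rewrite eqn_leq -(pfactor_dvdn _ p_pr (lcm_upto_gt0 k)).
rewrite dvdn_lcm_upto ?expn_gt0 ?prime_gt0 ?trunc_logP // andbT.
rewrite -(leq_exp2l _ _ p_gt1) -p_part dvdn_leq ?expn_gt0 ?prime_gt0 //.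
rewrite /lcm_upto big_add1 big_mkord partn_biglcm //.
apply/dvdn_biglcmP => i _; rewrite p_part dvdn_exp2l // trunc_log_max //.
by rewrite (leq_trans _ (ltn_ord i)) // dvdn_leq // pfactor_dvdnn.
Qed.

Lemma dvdn_mul_bin h j : (0 < j)%N -> (h %| j * 'C(h, j))%N.
Proof. by case: j => // j _; rewrite -mul_bin_diag dvdn_mulr. Qed.

Lemma lcm_upto_binD d x h k : (d %| h)%N ->
  (lcm_upto k * 'C(h + x, k) = lcm_upto k * 'C(x, k) %[mod d])%N.
Proof.
move=> dh; rewrite -binomial.Vandermonde big_ord_recl bin0 mul1n subn0.
rewrite mulnDr big_distrr.
(* The term of index 0 is the right-hand side, so the remaining ones must vanish modulo d. *)
apply/eqP; rewrite -[X in _ == X %[mod _]]addn0 eqn_modDl mod0n.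
apply: dvdn_sum => j _; rewrite /= mulnA dvdn_mulr //.
apply: dvdn_trans dh _; apply: dvdn_trans (dvdn_mul_bin h (ltn0Sn j)) _.
by rewrite dvdn_mul // dvdn_lcm_upto //=.
Qed.

Lemma lcm_upto_bin d x y k : (x = y %[mod d])%N ->
  (lcm_upto k * 'C(x, k) = lcm_upto k * 'C(y, k) %[mod d])%N.
Proof.
wlog le_yx : x y / (y <= x)%N.
  by move=> wl xy; case/orP: (leq_total y x) => /wl; [|move=> <- //]; apply.
move/eqP; rewrite eqn_mod_dvd // => /(lcm_upto_binD y k).
by rewrite subnK.
Qed.

(** Cancelling lcm(k) in [lcm_upto_bin] costs [trunc_log p k] powers of p. This is the uniform
    continuity that makes [padic_bin] well defined. *)
Lemma bin_eqmod p m n x y k : prime p -> (m + trunc_log p k <= n)%N ->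
  (x = y %[mod p ^ n] -> 'C(x, k) = 'C(y, k) %[mod p ^ m])%N.
Proof.
move=> p_pr le_n; wlog le_yx : x y / ('C(y, k) <= 'C(x, k))%N.
  move=> wl xy; case/orP: (leq_total 'C(y, k) 'C(x, k)) => /wl; first exact.
  by move=> <-.
move=> /(lcm_upto_bin k)/eqP.
rewrite eqn_mod_dvd ?leq_mul2l ?le_yx ?orbT // -mulnBr => dv.
apply/eqP; rewrite eqn_mod_dvd //.
(* Valuations only decide divisibility of positive numbers. *)
have [->|D0] := posnP ('C(x, k) - 'C(y, k)); first exact: dvdn0.
move: dv; rewrite !pfactor_dvdn ?muln_gt0 ?lcm_upto_gt0 //.
by rewrite lognM ?lcm_upto_gt0 // logn_lcm_upto //; move: le_n; lia.
Qed.

(** * Convergence in the p-adic topology *)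

Section PadicTopology.
Variables (p : nat) (p_pr : prime p).
Local Notation Zp := (padic_int p_pr).

Lemma padic_cvgP (f : nat -> Zp) (l : Zp) :
  f @ \oo --> l <-> forall m, \forall n \near \oo, f n m = l m.
Proof.
split=> [fl m|fl A].
  have proj_m : continuous (fun x : {ptws nat -> nat} => x m).
    exact: (@proj_continuous nat (fun=> nat) m).
  have cm : {for l, continuous (fun x : Zp => padic_proj x m)}.
    apply: (@continuous_comp Zp {ptws nat -> nat} nat (@padic_proj p p_pr)
      (fun x => x m)); last exact: proj_m.
    exact: (@initial_continuous Zp {ptws nat -> nat} (@padic_proj p p_pr)).
  have := cm _ (discrete_set1 (l m : nat)).
  by move=> /fl.
case=> B [[C oC <-] Cl] /= BA.
suff : (fun n => padic_proj (f n)) @ \oo --> padic_proj l.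
  move=> /(_ C (open_nbhs_nbhs (conj oC Cl))) [N _ fN].
  by exists N => // n /fN; apply: BA.
(* The product topology is a supremum of initial ones, so coordinates can be treated separately. *)
apply/cvg_sup => m U [/= _ [[V oV <-] Vl] VU].
rewrite nbhs_simpl; apply: filterS (fl m) => n fnm.
by apply: VU; rewrite /= /padic_proj /proj fnm.
Qed.
End PadicTopology.

(** * Residues, units and divisibility in the p-adic integers *)

Section PadicArithmetic.
Variables (p : nat) (p_pr : prime p).
Local Notation Zp := (padic_int p_pr).
Implicit Types (x y : Zp).

Let pX_gt0 n : (0 < p ^ n)%N. Proof. by rewrite expn_gt0 prime_gt0. Qed.

Lemma residue0 n : (0 : Zp) n = 0%N. Proof. exact: mod0n. Qed.

Lemma residueD x y n : (x + y) n = ((x n + y n) %% p ^ n)%N. Proof. by []. Qed.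

Lemma residueM x y n : (x * y) n = ((x n * y n) %% p ^ n)%N. Proof. by []. Qed.

Lemma residue_nat m n : (m%:R : Zp) n = (m %% p ^ n)%N.
Proof.
elim: m => [|m IHm]; first by rewrite residue0 mod0n.
by rewrite -addn1 natrD residueD IHm /= modnDm.
Qed.

Lemma residue_modn x m n : (m <= n)%N -> (x n %% p ^ m)%N = x m.
Proof.
move=> /subnK <-; elim: (n - m)%N => [|k IHk]; first exact: residue_mod.
by rewrite -IHk -(residueS x (k + m)) modn_dvdm // dvdn_exp2l // leq_addl.
Qed.

Lemma residue_subr_eq0 x y n : ((x - y) n == 0%N) = (x n == y n).
Proof.
apply/eqP/eqP => [xy0|xy].
  by rewrite -[x in LHS](subrK y) residueD xy0 add0n residue_mod.
by rewrite residueD xy -(residueD y (- y)) subrr residue0.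
Qed.

(** If x vanishes at level n, then p ^ n divides all later residues, and the quotients form the
    coherent sequence of the cofactor. *)
Lemma residue0P x n : x n = 0%N <-> exists d, x = (p ^ n)%:R * d.
Proof.
split=> [xn0|[d ->]]; last by rewrite residueM residue_nat modnn mul0n mod0n.
have dvd_x m : (p ^ n %| x (n + m)%N)%N.
  by rewrite /dvdn residue_modn ?leq_addr // xn0.
have dP m : (x (n + m.+1) %/ p ^ n = x (n + m) %/ p ^ n %[mod p ^ m])%N.
  by rewrite addnS -(residueS x (n + m)) expnD [(p ^ n * _)%N]mulnC
    -modn_divl modn_mod.
exists (padic_of p_pr dP); apply: padicP => m.
rewrite residueM residue_nat /= modnMm -(residue_modn x (leq_addl n m)).
by rewrite mulnC divnK.
Qed.

Lemma padic_unit x : x 1 != 0%N -> exists y, x * y = 1.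
Proof.
move=> x1; have co_x n : coprime (p ^ n) (x n).
  case: n => [|n]; first by rewrite expn0 coprime1n.
  rewrite coprimeXl // prime_coprime //; apply: contra x1.
  by rewrite -(residue_modn x (ltn0Sn n)) expn1.
pose c n := (egcdn (x n) (p ^ n)).1.
have cP n : (x n * c n = 1 %[mod p ^ n])%N.
  (* [egcdnP] needs a positive argument; a zero residue prime to p ^ n forces p ^ n = 1. *)
  rewrite /c; have [x0|x_gt0] := posnP (x n).
    by move: (co_x n); rewrite x0 /coprime gcdn0 => /eqP ->; rewrite !modn1.
  case: egcdnP => // u v + _ /=; rewrite mulnC => ->.
  by rewrite gcdnC (eqP (co_x n)) modnMDl.
have c_coh n : (c n.+1 = c n %[mod p ^ n])%N.
  have xc : (x n * c n.+1 = 1 %[mod p ^ n])%N.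
    have dvd_p := dvdn_exp2l p (leqnSn n).
    by rewrite -(residueS x n) modnMml -(modn_dvdm _ dvd_p) cP modn_dvdm.
  (* Uniqueness of inverses: both values invert x n modulo p ^ n. *)
  rewrite -[c n.+1]muln1 -modnMmr -(cP n) modnMmr mulnCA mulnA.
  by rewrite -modnMml xc modnMml mul1n.
exists (padic_of p_pr c_coh); apply: padicP => n.
by rewrite residueM /= modnMmr cP.
Qed.

Lemma padic_nat_unit m : coprime p m -> exists y : Zp, m%:R * y = 1.
Proof.
move=> co_pm; apply: padic_unit.
by rewrite residue_nat expn1 -/(dvdn p m) -prime_coprime.
Qed.

(** Here v is the valuation of x and y inverts its unit part: v + 1 is the least level at which x is
    nonzero, so the cofactor of p ^ v is a unit. *)
Lemma padic_neq0_dvd x : x != 0 ->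
  exists v y, x v = 0%N /\ x * y = (p ^ v)%:R.
Proof.
move=> x0; have ex_n : exists n, x n != 0%N.
  apply: contrapT => no_n; case/eqP: x0; apply: padicP => n; rewrite residue0.
  by apply/eqP; apply: contra_notT no_n; exists n.
case: (ex_minnP ex_n) => -[|v] xv minv.
  by move: xv; rewrite -residue_mod expn0 modn1.
have xv0 : x v = 0%N.
  by apply/eqP; apply: contraTT (ltnSn v) => /minv; rewrite -leqNgt.
have [w xE] := (residue0P x v).1 xv0.
have w1 : w 1 != 0%N.
  apply: contra xv => /eqP/residue0P[w' wE]; apply/eqP/residue0P; exists w'.
  by rewrite xE wE mulrA -natrM -expnD addn1.
have [c wc] := padic_unit w1; exists v, c; split=> //.
by rewrite xE -mulrA wc mulr1.
Qed.

(** For the converse, if v is the valuation of x - y, then Phi x - Phi y vanishes at level v, hence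
    is a multiple of p ^ v, which x - y divides. *)
Lemma congruence_preservingP (Phi : Zp -> Zp) :
  congruence_preserving Phi <-> forall x y n, x n = y n -> Phi x n = Phi y n.
Proof.
split=> [Phi_cp x y n /eqP|Phi_n x y].
  rewrite -residue_subr_eq0 => /eqP xy; apply/eqP; rewrite -residue_subr_eq0.
  by have [d ->] := Phi_cp x y; rewrite residueM xy muln0 mod0n.
have [->|] := eqVneq x y; first by exists 0; rewrite mul0r subrr.
rewrite -subr_eq0 => /padic_neq0_dvd[v [c [/eqP + xyc]]].
rewrite residue_subr_eq0 => /eqP/Phi_n/eqP; rewrite -residue_subr_eq0.
move=> /eqP/residue0P[e ->]; exists (c * e).
by rewrite -xyc [RHS]mulrC mulrA.
Qed.

(** In the p-adic integers, lcm(k) is a unit times the largest power of p not exceeding k, for k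
    positive. *)
Lemma lcm_upto_dvdP (a : Zp) k :
  padic_dvd (lcm_upto k)%:R a <->
  forall i, (p ^ i <= k)%N -> exists b : Zp, a = (p ^ i)%:R * b.
Proof.
split=> [[d ->] i le_k|a_dvd].
  have /dvdnP[q ->] := dvdn_lcm_upto (pX_gt0 i) le_k.
  by exists (d * q%:R); rewrite natrM mulrA mulrC.
have [->|k_gt0] := posnP k.
  by exists a; rewrite /lcm_upto big_geq // mulr1.
have [b ->] := a_dvd _ (trunc_logP (prime_gt1 p_pr) k_gt0).
have [m co_pm ->] := pfactor_coprime p_pr (lcm_upto_gt0 k).
rewrite logn_lcm_upto // natrM.
have [c mc] := padic_nat_unit co_pm; exists (b * c).
by rewrite mulrA -[b * c * _]mulrA [c * _]mulrC mc mulr1 mulrC.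
Qed.
End PadicArithmetic.

(** * Binomial functions on the p-adic integers and their series *)

Section MahlerSeries.
Variables (p : nat) (p_pr : prime p).
Local Notation Zp := (padic_int p_pr).
Implicit Types (x y : Zp).

Lemma padic_bin_residue k x m n : (m + trunc_log p k <= n)%N ->
  padic_bin k x m = ('C(x n, k) %% p ^ m)%N.
Proof.
pose b r := 'C(x (r + trunc_log p k)%N, k).
have bP r s : (r + trunc_log p k <= s)%N -> ('C(x s, k) = b r %[mod p ^ r])%N.
  move=> le_rs; apply: (bin_eqmod p_pr (leqnn _)).
  by rewrite residue_modn // residue_mod.
have b_coh r : (b r.+1 = b r %[mod p ^ r])%N by apply: bP; rewrite leq_add2r.
have bin_cvg : (fun n => (bin_mod p k n (x n))%:R : Zp) @ \oo
    --> padic_of p_pr b_coh.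
  apply/padic_cvgP => r; exists (r + trunc_log p k)%N => // s /= le_rs.
  rewrite residue_nat modn_dvdm ?bP // dvdn_exp2l //.
  exact: leq_trans (leq_addr _ _) le_rs.
(* The explicit limit only serves to prove convergence; the residue of [padic_bin k x] is then read
   off at one large index. *)
have /padic_cvgP/(_ m)[N _ binE] := cvgP _ bin_cvg.
move=> le_mn; rewrite bP // -[padic_bin k x]/(lim _).
rewrite -(binE (maxn N (m + trunc_log p k))) /= ?leq_maxl //.
rewrite residue_nat modn_dvdm; first by rewrite bP // leq_maxr.
by rewrite dvdn_exp2l // (leq_trans (leq_addr _ _) (leq_maxr _ _)).
Qed.

Lemma padic_bin_nat k j : padic_bin k (j%:R : Zp) = 'C(j, k)%:R.
Proof.
(* The extra j in the level ensures that j is its own residue there. *)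
apply: padicP => m; rewrite (padic_bin_residue _ (leq_addr j _)).
rewrite !residue_nat [(j %% _)%N]modn_small //.
apply: leq_trans (ltn_expl j (prime_gt1 p_pr)) _.
by rewrite leq_exp2l ?prime_gt1 // leq_addl.
Qed.

(** [padic_bin k] at level n is computed from residues at level n + [trunc_log p k], where x and y
    may differ; the factor lcm(k) makes agreement at level n sufficient, by [lcm_upto_bin]. *)
Lemma lcm_upto_padic_bin (c : Zp) k x y n :
  padic_dvd (lcm_upto k)%:R c -> x n = y n ->
  (c * padic_bin k x) n = (c * padic_bin k y) n.
Proof.
case=> d -> xy; rewrite -!mulrA !(residueM d); congr (_ %% _)%N.
congr (_ * _)%N; rewrite !residueM !residue_nat.
rewrite !(padic_bin_residue _ (leqnn _)) !modnMm.
by apply: lcm_upto_bin; rewrite !residue_modn ?leq_addr.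
Qed.

Lemma residue_sum (I : Type) (r : seq I) (F G : I -> Zp) n :
  (forall i, F i n = G i n) ->
  (\sum_(i <- r) F i) n = (\sum_(i <- r) G i) n.
Proof.
move=> FG; elim: r => [|i r IHr]; first by rewrite !big_nil.
by rewrite !big_cons !residueD FG IHr.
Qed.

Variables (a : nat -> Zp) (Phi : Zp -> Zp).
Hypothesis a_cvg : forall x, cvgn (series (fun k => a k * padic_bin k x)).
Hypothesis PhiE : forall x, Phi x = limn (series (fun k => a k * padic_bin k x)).

Lemma Mahler_residue x n : exists N, forall m, (N <= m)%N ->
  Phi x n = (\sum_(0 <= k < m) a k * padic_bin k x) n.
Proof.
have := @a_cvg x; rewrite -PhiE => /padic_cvgP/(_ n)[N _ NP].
by exists N => m /NP/= <-.
Qed.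

(** Terms of index above j vanish. The bound m is left free so that two arguments can be expanded
    with the same number of terms. *)
Lemma Mahler_nat j m : (j <= m)%N ->
  Phi j%:R = \sum_(k < m.+1) a k * 'C(j, k)%:R.
Proof.
move=> le_jm; apply: padicP => n.
have [N /(_ (maxn N m.+1) (leq_maxl _ _))->] := Mahler_residue j%:R n.
under eq_bigr do rewrite padic_bin_nat.
suff -> : \sum_(0 <= k < maxn N m.+1) a k * 'C(j, k)%:R =
  \sum_(k < m.+1) a k * 'C(j, k)%:R by [].
rewrite (big_cat_nat (leq0n m.+1) (leq_maxr _ _)) /= big_mkord.
rewrite [X in _ + X]big_nat_cond [X in _ + X]big1 ?addr0 // => k.
case/andP=> /andP[lt_mk _] _.
by rewrite bin_small ?mulr0 // (leq_ltn_trans le_jm).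
Qed.

Lemma Mahler_congruence_preserving :
  congruence_preserving Phi <-> forall k, padic_dvd (lcm_upto k)%:R (a k).
Proof.
split=> [/congruence_preservingP Phi_cp k|a_dvd]; last first.
  apply/congruence_preservingP => x y n xy.
  have [N NP] := Mahler_residue x n; have [M MP] := Mahler_residue y n.
  rewrite (NP _ (leq_maxl N M)) (MP _ (leq_maxr N M)).
  by apply: residue_sum => k; apply: lcm_upto_padic_bin.
elim/ltn_ind: k => k IHk; apply/lcm_upto_dvdP => i le_ik; apply/residue0P.
have kE : (k%:R : Zp) i = ((k - p ^ i)%:R : Zp) i.
  by rewrite !residue_nat -{1}(subnK le_ik) modnDr.
have pi_gt0 : (0 < p ^ i)%N by rewrite expn_gt0 prime_gt0.
have := Phi_cp _ _ _ kE; rewrite !(@Mahler_nat _ k) ?leq_subr //.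
have lastE (j : nat) : \sum_(l < k.+1) a l * 'C(j, l)%:R =
    \sum_(l < k) a l * 'C(j, l)%:R + a k * 'C(j, k)%:R by exact: big_ord_recr.
rewrite !lastE binn mulr1.
have lt_k : (k - p ^ i < k)%N by rewrite ltn_subrL pi_gt0 (leq_trans pi_gt0).
rewrite bin_small // mulr0 addr0 => /eqP.
rewrite -residue_subr_eq0 addrAC residueD.
suff -> : (\sum_(j < k) a j * 'C(k, j)%:R -
           \sum_(j < k) a j * 'C(k - p ^ i, j)%:R : Zp) i = 0%N.
  by rewrite add0n residue_mod => /eqP.
apply/eqP; rewrite residue_subr_eq0; apply/eqP; apply: residue_sum => j.
(* Going back to [padic_bin] allows the use of [kE], with the induction hypothesis for the
   coefficient. *)
by rewrite -!padic_bin_nat; apply: lcm_upto_padic_bin; first exact: IHk.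
Qed.
End MahlerSeries.

Theorem theorem26 (p : nat) (p_pr : prime p) (a : nat -> padic_int p_pr)
    (a_cvg : forall x : padic_int p_pr,
       cvgn (series (fun k => a k * padic_bin k x)))
    (Phi : padic_int p_pr -> padic_int p_pr)
    (PhiE : forall x : padic_int p_pr,
       Phi x = limn (series (fun k => a k * padic_bin k x))) :
  (congruence_preserving Phi <->
     forall k : nat, padic_dvd ((lcm_upto k)%:R) (a k)) /\
  ((forall k : nat, padic_dvd ((lcm_upto k)%:R) (a k)) <->
     forall i k : nat, (p ^ i <= k)%N ->
       exists b : padic_int p_pr, a k = (p ^ i)%:R * b).
Proof.
split; first exact: Mahler_congruence_preserving.
split=> [a_dvd i k|a_dvd k]; first exact: (lcm_upto_dvdP _ _).1.
by apply/lcm_upto_dvdP => i; apply: a_dvd.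
Qed.
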